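(* Let $T$ be a tree. Then $T$ admits a linear configuration if and only if $T$ is a path-like tree.
   Context: Path-like trees. Embed the path $P_n$ as a subgraph of a $2$-dimensional grid $P_k\times P_l$. For such an embedding consider the ordered sequence of subpaths $L_1,L_2,\ldots,L_m$ which are maximal straight segments of the embedding, the end of $L_i$ being the beginning of $L_{i+1}$. Suppose $L_i\cong P_2$ for some $i$ and some vertex $u$ of $L_{i-1}$ is at distance $1$ in the grid from a vertex $v$ of $L_{i+1}$. An elementary transformation replaces the edge of $L_i$ by the new edge $uv$. A tree $T$ of order $n$ is a path-like tree if it can be obtained from some embedding of $P_n$ in the $2$-dimensional grid by a sequence of elementary transformations. Linear configuration. A tree $T$ admits a linear configuration if there are paths $P^1_{k_1},\ldots,P^n_{k_n}$ with $V(P^i_{k_i})=\{v^i_1,\ldots,v^i_{k_i}\}$ and $E(P^i_{k_i})=\{v^i_1v^i_2,\ldots,v^i_{k_i-1}v^i_{k_i}\}$ (thought of as placed in this order on a horizontal line), whose vertex sets partition $V(T)$, whose edges are edges of $T$, and such that every other edge of $T$ joins two consecutive paths, i.e. is of the form $v^l_iv^{l+1}_j$ with $1\le l\le n-1$, and moreover: if $v^l_iv^{l+1}_j\in E(T)$ then $d_T(v^l_i,v^l_{k_l})=d_T(v^{l+1}_1,v^{l+1}_j)$ and $j>1$. Here $d_T$ denotes the distance in $T$. *)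

(* Defs.v *)
From mathcomp Require Import all_boot.
From Stdlib Require Import Relation_Operators.

Set Implicit Arguments.
Unset Strict Implicit.
Unset Printing Implicit Defensive.

Section Graphs.
Variables (T : finType) (e : rel T).

Definition simple_graph : Prop := symmetric e /\ irreflexive e.

(* For a symmetric irreflexive e, the duplicate-free e-cycles of length at
   most 2 are the empty one and the edges; longer ones are genuine cycles. *)
Definition is_tree : Prop :=
  [/\ simple_graph,
      0 < #|T|,
      forall x y : T, connect e x y
    & forall c : seq T, ucycle e c -> size c <= 2].

(* Least length of an e-walk from x to y; #|T| if y is unreachable from x. *)
Definition gdist (x y : T) : nat :=
  find (fun n => [exists p : n.-tuple T, path e x p && (last x p == y)])
       (iota 0 #|T|).

End Graphs.

Definition graph_iso (T U : finType) (e : rel T) (g : rel U) : Prop :=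
  exists2 h : T -> U, bijective h & forall x y, g (h x) (h y) = e x y.

Definition path_graph (n : nat) : rel 'I_n :=
  fun i j => (i.+1 == j :> nat) || (j.+1 == i :> nat).

Definition cartesian_product (T U : finType) (e : rel T) (g : rel U) :
    rel (T * U) :=
  fun p q => (p.1 == q.1) && g p.2 q.2 || e p.1 q.1 && (p.2 == q.2).

Definition grid (k l : nat) : rel ('I_k * 'I_l) :=
  cartesian_product (@path_graph k) (@path_graph l).

Definition replace_edge (T : finType) (g : rel T) (a b u v : T) : rel T :=
  fun x y => g x y && ([set x; y] != [set a; b]) || ([set x; y] == [set u; v]).

Section PathLike.
Variables (n k l : nat) (f : 'I_n -> 'I_k * 'I_l).

(* P_n as a (not necessarily induced) subgraph of the grid. *)
Definition path_embedding : Prop :=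
  injective f /\ forall i j, path_graph i j -> grid (f i) (f j).

(* A pair s of indices stands for the subpath f s.1, ..., f s.2. *)
Definition in_segment (s : 'I_n * 'I_n) (i : 'I_n) : bool := s.1 <= i <= s.2.

Definition straight (s : 'I_n * 'I_n) : Prop :=
  s.1 <= s.2 /\
  ((forall i, in_segment s i -> (f i).1 = (f s.1).1) \/
   (forall i, in_segment s i -> (f i).2 = (f s.1).2)).

Definition maximal_straight (s : 'I_n * 'I_n) : Prop :=
  straight s /\
  forall t, straight t -> t.1 <= s.1 -> s.2 <= t.2 -> t = s.

Definition straight_segments (L : seq ('I_n * 'I_n)) : Prop :=
  [/\ uniq L,
      forall s, s \in L <-> maximal_straight s
    & sorted (fun s t => s.2 == t.1) L].

(* The segments L are always those of the embedded path, while g is the current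
   graph on the vertices of the path, which is a path only at the start. *)
Definition elementary_transformation (L : seq ('I_n * 'I_n))
    (g g' : rel 'I_n) : Prop :=
  exists (La Lb Lc : 'I_n * 'I_n) (u v : 'I_n),
    [/\ infix [:: La; Lb; Lc] L,
        Lb.2 = Lb.1.+1 :> nat,
        [/\ in_segment La u, in_segment Lc v
          & gdist (@grid k l) (f u) (f v) = 1],
        g Lb.1 Lb.2 /\ ~~ g u v
      & g' =2 replace_edge g Lb.1 Lb.2 u v].

End PathLike.

Definition path_like (T : finType) (e : rel T) : Prop :=
  exists (n k l : nat) (f : 'I_n -> 'I_k * 'I_l) (L : seq ('I_n * 'I_n))
         (g : rel 'I_n),
    [/\ path_embedding f,
        straight_segments f L,
        clos_refl_trans _ (elementary_transformation f L) (@path_graph n) g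
      & graph_iso g e].

(* v l i is the i-th vertex of the l-th path, which has k l vertices; all
   indices start at 1, and values of k and v out of range are irrelevant. *)
Definition is_linear_configuration (T : finType) (e : rel T)
    (n : nat) (k : nat -> nat) (v : nat -> nat -> T) : Prop :=
  let idx l i := (1 <= l <= n) && (1 <= i <= k l) in
  [/\ forall l, 1 <= l <= n -> 1 <= k l,
      (forall x, exists l i, idx l i /\ v l i = x) /\
      (forall l i l' i', idx l i -> idx l' i' -> v l i = v l' i' ->
         l = l' /\ i = i'),
      forall l i, idx l i -> idx l i.+1 -> e (v l i) (v l i.+1),
      forall x y, e x y -> exists l i,
        (idx l i /\ idx l i.+1 /\ [set x; y] = [set v l i; v l i.+1]) \/
        (exists j, idx l i /\ idx l.+1 j /\ [set x; y] = [set v l i; v l.+1 j])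
    & forall l i j, idx l i -> idx l.+1 j -> e (v l i) (v l.+1 j) ->
        gdist e (v l i) (v l (k l)) = gdist e (v l.+1 1) (v l.+1 j) /\ 1 < j].

Definition admits_linear_configuration (T : finType) (e : rel T) : Prop :=
  exists n k v, @is_linear_configuration T e n k v.

(* Main.v *)
Require Import Defs.
From mathcomp Require Import all_boot zify.
From Stdlib Require Import Relation_Operators.

Set Implicit Arguments.
Unset Strict Implicit.
Unset Printing Implicit Defensive.

(* Both notions describe the same thing: a path 0, ..., N - 1 in which some edges
   {b, b + 1} are replaced by {b - d, b + 1 + d} with d > 0, where no other
   replaced edge lies between b - d and b + 1 + d.
   In a linear configuration of a tree, consecutive paths are joined by exactly
   one edge, and the distance condition centres that edge at the gap between
   them. In an embedded path, an elementary transformation can only join two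
   vertices at equal distance from the edge it removes, and two of them never
   overlap because two diagonally opposite grid points have only two common
   neighbours. Conversely, drawing the pieces between the replaced edges as
   successive rows, run through in alternating directions, puts the ends of each
   new edge on top of each other. *)

(** * Paths and distances in trees *)

(** If the paths leave [x] towards different vertices [a] and [b], their common end connects [a] to
    [b] in the graph without [x]. A simple connection of this kind closes up through [x] to a cycle
    of length at least 3. *)
Lemma tree_path_unique (T : finType) (e : rel T) : is_tree e ->
  forall (x : T) (p q : seq T), path e x p -> path e x q ->
  uniq (x :: p) -> uniq (x :: q) -> last x p = last x q -> p = q.
Proof.
case=> -[sym irr] _ _ acyc x p; elim: p x => [|a p IH] x [|b q] //=.
- by move=> _ _ _ /andP[/negP xN _] lxq; case: xN; rewrite {1}lxq mem_last.
- by move=> _ _ /andP[/negP xN _] _ lxq; case: xN; rewrite -{1}lxq mem_last.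
move=> /andP[exa pa] /andP[exb qb] /andP[xp up] /andP[xq uq] lpq.
have [eab|neq] := eqVneq a b; first by subst b; rewrite (IH a q).
pose r := [rel u w | [&& e u w, u != x & w != x]].
have rsym : connect_sym r.
  by apply: sym_connect_sym => u w; rewrite /= sym; congr (_ && _); rewrite andbC.
have toconnect c s : path e c s -> x \notin c :: s -> connect r c (last c s).
  elim: s c => [|w s IHs] c //= /andP[ecw pw].
  rewrite inE negb_or => /andP[xc xw].
  apply: connect_trans (IHs w pw xw); apply: connect1 => /=.
  by move: xw; rewrite inE negb_or eq_sym => /andP[xw _]; rewrite ecw eq_sym xc xw.
have : connect r a b.
  apply: connect_trans (toconnect a p pa xp) _.
  by rewrite rsym lpq; apply: toconnect.
case/connectP => s0 /shortenP[s rs us _] lb.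
have es : path e a s by apply: sub_path rs => u w /and3P[].
have xs : x \notin s.
  have : all (predC1 x) s.
    elim: s a rs {us lb es exa pa xp up IH lpq neq} => //= w s IHs a.
    by case/andP=> /and3P[_ _ ->] /IHs.
  by apply: contraL => xs; apply/allPn; exists x; rewrite //= negbK.
have /acyc : ucycle e [:: x, a & s].
  rewrite /ucycle /ucycleb /= exa rcons_path es -lb sym exb /=.
  move: xp us; rewrite !inE !negb_or xs => /andP[-> _] /= /andP[-> ->].
  by [].
by case: s lb {rs us es xs} => [/= ba|//]; rewrite ba eqxx in neq.
Qed.

(** Any walk shortens to a duplicate-free one with the same ends, which must be [p] by
    uniqueness. *)
Lemma tree_gdist (T : finType) (e : rel T) : is_tree e ->
  forall (x : T) (p : seq T), path e x p -> uniq (x :: p) ->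
  gdist e x (last x p) = size p.
Proof.
move=> tree x p pp up.
set P := fun n => [exists q : n.-tuple T, path e x q && (last x q == last x p)].
(* [gdist] tries only lengths below [#|T|], so [size p] has to be one of them. *)
have lt_p : size p < #|T|.
  by rewrite -[(size p).+1]/(size (x :: p)) -(card_uniqP up) max_card.
have Pp : P (size p).
  by apply/existsP; exists (in_tuple p); rewrite /= pp eqxx.
have Pmin m : P m -> size p <= m.
  case/existsP=> q /andP[pq /eqP lq].
  have := size_tuple q; move: (q : seq T) pq lq => {}q pq lq <-.
  case: (shortenP pq) lq => s ps us sub ls.
  rewrite -(tree_path_unique tree ps pp us up ls).
  by case/andP: us => _ us; apply: uniq_leq_size.
rewrite /gdist -/P; apply/eqP; rewrite eqn_leq; apply/andP; split.
  rewrite leqNgt; apply/negP => /(before_find 0).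
  by rewrite nth_iota // add0n Pp.
have hasP' : has P (iota 0 #|T|).
  by apply/hasP; exists (size p); rewrite // mem_iota.
have := nth_find 0 hasP'.
by move: hasP'; rewrite has_find size_iota => lt_f; rewrite nth_iota // => /Pmin.
Qed.

Lemma last_run (T : Type) (w : nat -> T) (m p : nat) :
  last (w p) (map w (iota p.+1 m)) = w (p + m).
Proof.
elim: m p => [|m IH] p /=; first by rewrite addn0.
by rewrite IH addSnnS.
Qed.

Lemma path_run (T : Type) (e : rel T) (w : nat -> T) (p m : nat) :
  (forall c, p <= c < p + m -> e (w c) (w c.+1)) ->
  path e (w p) (map w (iota p.+1 m)).
Proof.
elim: m p => [|m IH] p //= ew; rewrite ew ?IH //; last by lia.
by move=> c cm; apply: ew; lia.
Qed.

Lemma tree_gdist_run (T : finType) (e : rel T) : is_tree e ->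
  forall (w : nat -> T) (p m : nat),
  (forall c, p <= c < p + m -> e (w c) (w c.+1)) ->
  (forall c c', p <= c <= p + m -> p <= c' <= p + m -> w c = w c' -> c = c') ->
  gdist e (w p) (w (p + m)) = m.
Proof.
move=> tree w p m ew winj.
rewrite -last_run tree_gdist ?size_map ?size_iota //; first exact: path_run.
rewrite -[_ :: _]/(map w (iota p m.+1)) map_inj_in_uniq ?iota_uniq //.
by move=> c c'; rewrite !mem_iota => cm cm' /winj; apply; lia.
Qed.

Lemma gdist_eq1 (T : finType) (e : rel T) (x y : T) : irreflexive e ->
  (gdist e x y == 1) = e x y.
Proof.
move=> irr; rewrite /gdist; set P := fun n => [exists q : n.-tuple T, _].
have P0 : P 0 = (x == y).
  by apply/existsP/idP => [[q]|xy]; [rewrite (tuple0 q)|exists [tuple]].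
have P1 : P 1 = e x y.
  apply/existsP/idP => [[q]|exy].
    by case/tupleP: q => z q; rewrite (tuple0 q) /= andbT => /andP[exz /eqP <-].
  by exists [tuple y]; rewrite /= exy eqxx.
have [xy|xy] := eqVneq x y.
  subst y; have : 0 < #|T| by apply/card_gt0P; exists x.
  by case: #|T| => // k _; rewrite /= P0 eqxx irr.
(* Length 1 is then among those tried, and the default value [#|T|] differs from 1. *)
have : 1 < #|T|.
  rewrite -[2](_ : #|[set x; y]| = _); first exact: max_card.
  by rewrite cards2 xy.
case: #|T| => [|[|k]] // _; rewrite /= P0 (negbTE xy) P1.
by case: (e x y).
Qed.

Lemma eq_set2 (T : finType) (x y a b : T) :
  ([set x; y] == [set a; b]) = (x == a) && (y == b) || (x == b) && (y == a).
Proof.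
apply/eqP/orP => [E|[]/andP[/eqP -> /eqP ->] //]; last by rewrite setUC.
have := set21 x y; have := set22 x y; rewrite E => /set2P hy /set2P hx.
have := set21 a b; have := set22 a b; rewrite -E => /set2P hb /set2P ha.
by case: hx hy ha hb => ? [] ? [] ? [] ?; subst; rewrite !eqxx; auto.
Qed.

(** * Folded paths *)

(* The path 0, 1, ..., N - 1 in which each edge {b, b + 1} is replaced by
   {b - d b, b + 1 + d b}. The ends of the new edge still add up to 2 b + 1,
   so an edge {i, j} determines its centre b = (i + j)./2. *)
Definition fold_rel (d : nat -> nat) : rel nat :=
  fun i j => odd (i + j) && (minn i j + d (i + j)./2 == (i + j)./2).

(** The range of [c] covers exactly the path edges {c, c + 1} between the ends of the new edge
    centred at [b]; the two bounds keep these ends on the path. *)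
Definition fold_data (N : nat) (d : nat -> nat) : Prop :=
  forall b, b.+1 < N ->
    [/\ d b <= b, b.+1 + d b < N
      & 0 < d b -> forall c, b - d b <= c <= b + d b -> c != b -> d c = 0].

(** [h] lives on all of [nat] so that index arithmetic needs no casts; only its values below [N]
    matter. *)
Definition folded (T : finType) (e : rel T) : Prop :=
  exists (N : nat) (d : nat -> nat) (h : nat -> T),
    [/\ 0 < N /\ fold_data N d,
        forall p q, p < N -> q < N -> h p = h q -> p = q,
        forall x, exists2 p, p < N & h p = x
      & forall p q, p < N -> q < N -> e (h p) (h q) = fold_rel d p q].

Lemma fold_rel_sym d : symmetric (fold_rel d).
Proof. by move=> p q; rewrite /fold_rel addnC minnC. Qed.

Lemma fold_rel_lt d p q : p < q -> fold_rel d p q ->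
  exists b, [/\ p + d b = b, q = b.+1 + d b & p + q = b.*2.+1].
Proof.
by move=> pq /andP[o /eqP E]; exists (p + q)./2; split; lia.
Qed.

Lemma fold_rel_center d b p q : p <= q -> p + q = b.*2.+1 ->
  fold_rel d p q = (p + d b == b).
Proof.
move=> pq E; rewrite /fold_rel (_ : (p + q)./2 = b); last lia.
by rewrite (minn_idPl pq) E /= odd_double.
Qed.

(** The effect of one elementary transformation: since an edge determines its centre, changing the
    offset at one centre exchanges a single edge. *)
Lemma fold_rel_replace (d d' : nat -> nat) (b i j : nat) :
  d b = 0 -> d' b <= b -> (forall c, c != b -> d' c = d c) ->
  fold_rel d' i j =
    fold_rel d i j && ~~ ((i == b) && (j == b.+1) || (i == b.+1) && (j == b)) ||
    ((i == b - d' b) && (j == b.+1 + d' b) || (i == b.+1 + d' b) && (j == b - d' b)).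
Proof.
move=> db db' dd'; rewrite /fold_rel.
case: ((i + j)./2 =P b) => [Eb|neq]; last by rewrite dd' ?(introN eqP neq) //; lia.
by rewrite Eb db; lia.
Qed.

Lemma crossing_edge (T : Type) (e : rel T) (A : pred T) (x : T) (p : seq T) :
  path e x p -> A x -> ~~ A (last x p) -> exists u w, [/\ e u w, A u & ~~ A w].
Proof.
elim: p x => [|y p IH] x /=; first by move=> _ ->.
case/andP=> exy py Ax; case: (boolP (A y)) => [Ay|nAy _]; first exact: IH.
by exists x, y.
Qed.

(* B marks the places where two consecutive paths of the configuration meet.
   Connectedness gives at least one edge across each of them and acyclicity at
   most one. *)
Lemma folded_of_cuts (T : finType) (e : rel T) (N : nat) (h : nat -> T)
    (B : pred nat) :
  is_tree e -> 0 < N ->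
  (forall p q, p < N -> q < N -> h p = h q -> p = q) ->
  (forall x, exists2 p, p < N & h p = x) ->
  (forall c, c.+1 < N -> ~~ B c -> e (h c) (h c.+1)) ->
  (forall p q, p < q -> q < N -> e (h p) (h q) ->
     exists b, [/\ p + q = b.*2.+1,
                   forall c, p <= c < q -> c != b -> ~~ B c & B b = (p < b)]) ->
  folded e.
Proof.
move=> tree N0 hinj hsurj eB Bedge.
have [[sym irr] _ conn acyc] := tree.
pose Q b δ := [&& δ <= b, b.+1 + δ < N & e (h (b - δ)) (h (b.+1 + δ))].
have QB b δ : Q b δ -> B b = (0 < δ) /\
    forall c, b - δ <= c <= b + δ -> c != b -> ~~ B c.
  case/and3P=> δb bN /Bedge[]; [lia|lia|] => b' [E Bc Bb].
  have ? : b' = b by lia.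
  by subst b'; split=> [|c cb /Bc]; [rewrite Bb; lia|apply; lia].
have Qex b : b.+1 < N -> exists δ, Q b δ.
  move=> bN; case: (boolP (B b)) => [Bb|nB]; last first.
    by exists 0; rewrite /Q subn0 addn0 bN eB.
  (* A walk from [h b] to [h b.+1] leaves the initial part up to [b] along some edge. That edge
     spans the marked place [b], so it is centred there. *)
  pose A := [pred x | [exists i : 'I_N, (i <= b) && (h i == x)]].
  have /connectP[s es ls] := conn (h b) (h b.+1).
  have : A (h b).
    by apply/existsP; exists (Ordinal (ltnW bN)); rewrite /= leqnn eqxx.
  have nA : ~~ A (last (h b) s).
    rewrite -ls; apply/existsPn => i; rewrite negb_and -implybE.
    apply/implyP => ib; apply/eqP => /hinj E.
    by have := E (ltn_ord i) bN; lia.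
  move=> Ab; have [u [w [euw /existsP[p /andP[pb /eqP Eu]] nAw]]] :=
    crossing_edge es Ab nA.
  have [q qN Ew] := hsurj w.
  have bq : b < q.
    rewrite ltnNge; apply/negP => qb; case/negP: nAw; apply/existsP.
    by exists (Ordinal qN); rewrite /= qb Ew eqxx.
  subst u w; have [||b' [E Bc Bb']] := Bedge p q _ _ euw => //; first lia.
  have ? : b' = b.
    apply/eqP/negPn/negP => bb'; have := Bc b; rewrite Bb eq_sym => H.
    by have : false by apply: H => //; lia.
  subst b'; exists (b - p); rewrite /Q.
  rewrite (_ : b - (b - p) = p); last lia.
  by rewrite (_ : b.+1 + (b - p) = q); [rewrite qN euw; lia|lia].
have Quniq b δ δ' : Q b δ -> Q b δ' -> δ < δ' -> False.
  move=> Qd Qd' dd'.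
  have [Bb _] := QB _ _ Qd; have [Bb' Bc] := QB _ _ Qd'.
  case/and3P: Qd => db dN ed; case/and3P: Qd' => db' dN' ed'.
  (* The two edges, together with the unmarked runs joining their ends on either side of [b], form a
     cycle of length 2 (m + 1). *)
  set p := b - δ'; set q := b.+1 + δ; set m := δ' - δ.
  have run c : p <= c < b.+1 + δ' -> c != b -> e (h c) (h c.+1).
    by move=> cpq cb; apply: eB; [lia|apply: Bc => //; lia].
  have : ucycle e (map h (iota p m.+1 ++ iota q m.+1)).
    apply/andP; split.
      rewrite map_cat /= rcons_cat cat_path last_run path_run; last first.
        by move=> c cpm; apply: run; lia.
      rewrite /= rcons_path last_run path_run; last first.
        by move=> c cpm; apply: run; lia.
      rewrite (_ : p + m = b - δ) ?ed; last lia.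
      by rewrite (_ : q + m = b.+1 + δ'); [rewrite sym ed'|lia].
    rewrite map_inj_in_uniq ?cat_uniq ?iota_uniq ?andbT ?andTb.
      by apply/negP=> /hasP[c]; rewrite inE !mem_iota; lia.
    move=> c c'; rewrite !mem_cat !mem_iota => cm cm'; apply: hinj; lia.
  by move/acyc; rewrite size_map size_cat !size_iota; lia.
pose d b := find (Q b) (iota 0 N).
have dQ b : b.+1 < N -> Q b (d b).
  move=> bN; have /[dup] H : has (Q b) (iota 0 N).
    have [δ Qδ] := Qex b bN; apply/hasP; exists δ => //.
    by rewrite mem_iota; case/and3P: Qδ; lia.
  by rewrite has_find size_iota => H'; have := nth_find 0 H; rewrite nth_iota.
exists N, d, h; split=> //.
  split=> // b bN; have Qb := dQ b bN; have /and3P[db dN _] := Qb.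
  split=> // d0 c cb ncb; have [_ Bc] := QB _ _ Qb.
  have cN : c.+1 < N by lia.
  have [Bc' _] := QB _ _ (dQ c cN).
  by have := Bc c cb ncb; rewrite Bc'; lia.
have main p q : p < q -> q < N -> e (h p) (h q) = fold_rel d p q.
  move=> pq qN; apply/idP/idP => [epq|/(fold_rel_lt pq)[b [pb qb E]]].
    have [b [E _ _]] := Bedge p q pq qN epq.
    rewrite (fold_rel_center d (ltnW pq) E).
    have Q1 : Q b (b - p).
      rewrite /Q (_ : b - (b - p) = p); last lia.
      by rewrite (_ : b.+1 + (b - p) = q); [rewrite qN epq; lia|lia].
    have Q2 : Q b (d b) by apply: dQ; lia.
    have := Quniq _ _ _ Q1 Q2; have := Quniq _ _ _ Q2 Q1.
    by case: (ltngtP (d b) (b - p)) => [_ F _|_ _ F|-> *]; [case: F|case: F|lia].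
  have /and3P[_ _] : Q b (d b) by apply: dQ; lia.
  by rewrite (_ : b - d b = p) -?qb //; lia.
move=> p q pN qN; case: (ltngtP p q) => [pq|qp|->].
- exact: main.
- by rewrite sym fold_rel_sym; apply: main.
- by rewrite irr /fold_rel addnn odd_double.
Qed.

(** * Linear configurations *)

(** The vertices are numbered row after row, and the cuts are the last positions of the rows except
    the final one. Equal distances to the gap between two rows mean that a linking edge is centred
    at the cut there. *)
Lemma linear_folded (T : finType) (e : rel T) :
  is_tree e -> admits_linear_configuration e -> folded e.
Proof.
move=> tree [n [k [v [k1 [vsurj vinj] vrow vedge vlink]]]].
pose S l := \sum_(1 <= j < l) k j.
have Srec l : 0 < l -> S l.+1 = S l + k l by move=> l0; rewrite /S big_nat_recr.
have Smono l l' : l <= l' -> S l <= S l'.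
  elim: l' => [|l' IH]; first by case: l.
  rewrite leq_eqVlt => /predU1P[->//|]; rewrite ltnS => /IH le.
  case: (posnP l') le => [->|/Srec->]; last lia.
  by rewrite (_ : S 1 = S 0) // /S !big_geq.
(* Rows are numbered from 1: index [l] of the search stands for row [l.+1], which ends just before
   [S l.+2]. *)
pose row p := (find (fun l => p < S l.+2) (iota 0 n)).+1.
pose N := S n.+1; pose h p := v (row p) (p - S (row p)).+1.
have rowP p : p < N -> 1 <= row p <= n /\ S (row p) <= p < S (row p).+1.
  move=> pN; have n0 : 0 < n.
    by rewrite lt0n; apply/eqP => n0; move: pN; rewrite /N n0 /S big_geq.
  have /[dup] H : has (fun l => p < S l.+2) (iota 0 n).
    by apply/hasP; exists n.-1; rewrite ?mem_iota ?prednK //; lia.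
  rewrite has_find size_iota => rn; split; first by rewrite /row; lia.
  have := nth_find 0 H; rewrite nth_iota // add0n => ->; rewrite andbT /row.
  case E : (find _ _) => [|l]; first by rewrite /S big_geq.
  have lt : l < find (fun l => p < S l.+2) (iota 0 n) by rewrite E.
  have := before_find 0 lt; rewrite nth_iota ?add0n; last lia.
  by move/negbT; rewrite -leqNgt.
have rowE p l : 1 <= l <= n -> S l <= p < S l.+1 -> p < N /\ row p = l.
  move=> ln pl; have pN : p < N by apply: leq_trans (Smono l.+1 n.+1 _); lia.
  split=> //; have [rn rp] := rowP p pN.
  case: (ltngtP (row p) l) => // /Smono; lia.
have pos l i : (1 <= l <= n) && (1 <= i <= k l) ->
    [/\ S l + i.-1 < N, row (S l + i.-1) = l & h (S l + i.-1) = v l i].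
  case/andP=> ln ik; have [|pN rp] := rowE (S l + i.-1) l ln.
    by rewrite Srec; lia.
  by split=> //; rewrite /h rp; congr v; lia.
have idxh p : p < N -> (1 <= row p <= n) && (1 <= (p - S (row p)).+1 <= k (row p)).
  by move=> /rowP[rn]; rewrite Srec; lia.
have distrow l i j : 1 <= l <= n -> 1 <= i <= j -> j <= k l ->
    gdist e (v l i) (v l j) = j - i.
  move=> ln ij jk; rewrite -{1}(_ : i + (j - i) = j); last lia.
  apply: (tree_gdist_run tree (w := v l)) => [c ci|c c' ci ci'].
    by apply: vrow; lia.
  by case/(vinj _ _ _ _ _ _); lia.
have [[sym irr] T0 _ _] := tree.
apply: (@folded_of_cuts _ _ N h (fun c => row c != row c.+1)) => //.
- have /card_gt0P[x _] := T0; have [l [i [li _]]] := vsurj x.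
  by case: (pos l i li) => [lN _ _]; lia.
- move=> p q pN qN /(vinj _ _ _ _ (idxh p pN) (idxh q qN)) [Er Ei].
  by have := rowP p pN; have := rowP q qN; rewrite Er in Ei *; lia.
- move=> x; have [l [i [li <-]]] := vsurj x.
  by have [lN _ E] := pos l i li; exists (S l + i.-1).
- move=> c cN /negPn/eqP Er; rewrite /h -Er.
  have rc := rowP c (ltnW cN); have rc' := rowP _ cN.
  rewrite (_ : c.+1 - S (row c) = (c - S (row c)).+1); last lia.
  by apply: vrow; [exact/idxh/ltnW|have := idxh _ cN; rewrite -Er; lia].
move=> p q pq qN epq; have pN : p < N by lia.
have hinj p' : p' < N -> forall l i, (1 <= l <= n) && (1 <= i <= k l) ->
    h p' = v l i -> p' = S l + i.-1 /\ row p' = l.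
  move=> p'N l i li /(vinj _ _ _ _ (idxh p' p'N) li) [Er Ei].
  by split=> //; have := rowP p' p'N; rewrite Er in Ei *; lia.
have [l [i [[li [li' E]]|[j [li [lj E]]]]]] := vedge _ _ epq.
  move/eqP: E; rewrite eq_set2 => /orP[]/andP[/eqP Ep /eqP Eq].
    have [Pp rp] := hinj p pN _ _ li Ep; have [Pq rq] := hinj q qN _ _ li' Eq.
    have qp : q = p.+1 by lia.
    exists p; split; first lia.
      by move=> c cp; lia.
    by rewrite ltnn -qp rp rq eqxx.
  have [Pp rp] := hinj p pN _ _ li' Ep; have [Pq rq] := hinj q qN _ _ li Eq.
  by lia.
have Sl : S l.+1 = S l + k l by apply: Srec; lia.
have Sl' : S l.+2 = S l.+1 + k l.+1 by apply: Srec; lia.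
move/eqP: E; rewrite eq_set2 => /orP[]/andP[/eqP Ep /eqP Eq]; last first.
  have [Pp rp] := hinj p pN _ _ lj Ep; have [Pq rq] := hinj q qN _ _ li Eq.
  by lia.
have [Pp rp] := hinj p pN _ _ li Ep; have [Pq rq] := hinj q qN _ _ lj Eq.
have [] := vlink l i j li lj; first by rewrite -Ep -Eq.
rewrite !distrow; [|lia..] => D j1.
have rowl c : S l <= c < S l.+1 -> row c = l.
  by move=> cl; case: (rowE c l _ cl) => //; lia.
have rowl' c : S l.+1 <= c < S l.+2 -> row c = l.+1.
  by move=> cl; case: (rowE c l.+1 _ cl) => //; lia.
(* The centre is the last position of row [l]. It is a cut, and [1 < j] puts [p] strictly before
   it. *)
exists (S l + k l).-1; split; first lia.
  move=> c cpq cb; apply/negPn/eqP.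
  case: (ltngtP c (S l + k l).-1) => cb'; last lia.
    by rewrite !rowl //; lia.
  by rewrite !rowl' //; lia.
by rewrite rowl ?rowl'; lia.
Qed.

(** The number of replaced edges before [p]. It serves as the row index, counted from 0, in the
    linear configuration and as the height in the zigzag drawing. *)
Fixpoint fold_row (d : nat -> nat) (p : nat) : nat :=
  if p is q.+1 then fold_row d q + (0 < d q) else 0.

Lemma fold_row_mono d p q : p <= q -> fold_row d p <= fold_row d q.
Proof.
elim: q => [|q IH]; first by case: p.
by rewrite leq_eqVlt => /predU1P[->//|]; rewrite ltnS => /IH /=; lia.
Qed.

Lemma fold_row_const d p q : p <= q -> (forall c, p <= c < q -> d c = 0) ->
  fold_row d q = fold_row d p.
Proof.
elim: q => [|q IH]; first by case: p.
rewrite leq_eqVlt => /predU1P[->//|]; rewrite ltnS => pq d0 /=.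
rewrite IH // ?d0 ?addn0 //; first by lia.
by move=> c cp; apply: d0; lia.
Qed.

(** The rows are the level sets of [fold_row]. No other replaced edge lies between the ends of a new
    edge, so these ends are in consecutive rows, each at distance [d b] from the gap. *)
Lemma folded_linear (T : finType) (e : rel T) :
  is_tree e -> folded e -> admits_linear_configuration e.
Proof.
move=> tree [N [d [h [[N0 dN] hinj hsurj eh]]]].
pose y := fold_row d.
(* First position of row [l]. Past the last row the search fails and returns [N], which gives the
   last row its correct length. *)
pose st l := find (fun p => l <= (y p).+1) (iota 0 N).
have stN l : st l <= N by rewrite -[X in _ <= X](size_iota 0); apply: find_size.
have stP l p : p < N -> (st l <= p) = (l <= (y p).+1).
  move=> pN; case: (ltnP p (st l)) => [lt|ge].
    by have := before_find 0 lt; rewrite nth_iota // add0n.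
  have /[dup] H : has (fun p => l <= (y p).+1) (iota 0 N).
    by rewrite has_find size_iota; apply: leq_ltn_trans pN.
  rewrite has_find size_iota => ltN.
  have := nth_find 0 H; rewrite nth_iota // add0n => le.
  by apply/esym/(leq_trans le); rewrite ltnS; apply: fold_row_mono.
pose n := (y N.-1).+1; pose k l := st l.+1 - st l.
pose v l i := h (st l + i.-1).
have pos l i : (1 <= l <= n) && (1 <= i <= k l) ->
    st l + i.-1 < N /\ (y (st l + i.-1)).+1 = l.
  case/andP=> ln; rewrite /k => ik; have pN : st l + i.-1 < N by have := stN l.+1; lia.
  by split=> //; have := stP l _ pN; have := stP l.+1 _ pN; lia.
have idxh p : p < N -> [/\ (1 <= (y p).+1 <= n), st (y p).+1 <= p
    & p - st (y p).+1 < k (y p).+1].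
  move=> pN; have := stP (y p).+1 p pN; have := stP (y p).+2 p pN.
  have : y p <= y N.-1 by apply: fold_row_mono; lia.
  by rewrite /k /n => *; split; lia.
have hidx p : p < N -> exists i, [/\ (1 <= (y p).+1 <= n) && (1 <= i <= k (y p).+1),
     i = (p - st (y p).+1).+1, p = st (y p).+1 + i.-1 & v (y p).+1 i = h p].
  move=> pN; have [a b c] := idxh p pN.
  exists (p - st (y p).+1).+1; split=> //; first lia.
    by rewrite /=; lia.
  by congr h => /=; lia.
(* [fold_row] grows by at most 1 at each step, so no row is empty. *)
have stl l : 1 <= l <= n -> st l < N /\ (y (st l)).+1 = l.
  move=> ln; have sN : st l < N.
    by apply: (@leq_ltn_trans N.-1); [rewrite stP|]; lia.
  split=> //; have := stP l _ sN; rewrite leqnn => /esym.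
  case E : (st l) => [|p] /=; first by rewrite /y /=; lia.
  have := stP l p; rewrite /y /= in sN *; lia.
exists n, k, v; split.
- move=> l ln; have [sN yl] := stl l ln.
  by have := stP l.+1 _ sN; rewrite /k; lia.
- split=> [x|l i l' i' li li' E].
    have [p pN <-] := hsurj x; have [i [li _ _ vE]] := hidx p pN.
    by exists (y p).+1, i.
  have [pN yp] := pos _ _ li; have [pN' yp'] := pos _ _ li'.
  have E' := hinj _ _ pN pN' E.
  have ll : l = l' by rewrite -yp -yp' E'.
  by subst l'; lia.
- move=> l i li li'; have [pN yp] := pos _ _ li; have [pN' yp'] := pos _ _ li'.
  have E : st l + i.+1.-1 = (st l + i.-1).+1 by lia.
  rewrite E in pN' yp'; rewrite /v E eh // (@fold_rel_center _ (st l + i.-1)) //;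
    last lia.
  by have /= := yp'; rewrite /y /= -/y; lia.
- have main p q : p < q -> q < N -> fold_rel d p q -> exists l i,
    ((1 <= l <= n) && (1 <= i <= k l) /\ (1 <= l <= n) && (1 <= i.+1 <= k l) /\
      h p = v l i /\ h q = v l i.+1) \/
    (exists j, (1 <= l <= n) && (1 <= i <= k l) /\
      (1 <= l.+1 <= n) && (1 <= j <= k l.+1) /\ h p = v l i /\ h q = v l.+1 j).
    move=> pq qN /(fold_rel_lt pq)[b [Ep Eq _]].
    have pN : p < N by lia.
    have [i [li Ei Pp vp]] := hidx p pN.
    have [j [lj Ej Pq vq]] := hidx q qN.
    have [db bN nc] : [/\ d b <= b, b.+1 + d b < N & _] := dN b ltac:(lia).
    exists (y p).+1, i; case: (posnP (d b)) => d0; [left|right].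
      have ? : p = b by lia.
      have ? : q = b.+1 by lia.
      have yq : y q = y p by subst p q; rewrite /y d0 addn0 /= d0 addn0.
      rewrite yq in lj Ej Pq vq.
      have ji : j = i.+1 by lia.
      by rewrite -ji.
    exists j; have yp : y b = y p.
      by apply: fold_row_const => [|c cb]; [|apply: nc]; lia.
    have yq : y q = y b.+1.
      by apply: fold_row_const => [|c cb]; [|apply: nc]; lia.
    have E : y q = (y p).+1 by rewrite yq /y /= -/y yp d0 addn1.
    by rewrite E in lj vq.
  move=> x z; have [p pN <-] := hsurj x; have [q qN <-] := hsurj z.
  rewrite eh // => epq; have [[sym irr] _ _ _] := tree.
  case: (ltngtP p q) => [pq|qp|E]; last first.
  + by move: epq; rewrite -eh // E irr.
  + rewrite fold_rel_sym in epq.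
    have [l [i [[li [li' [-> ->]]]|[j [li [lj [-> ->]]]]]]] := main q p qp pN epq.
      by exists l, i; left; rewrite setUC.
    by exists l, i; right; exists j; rewrite setUC.
  + have [l [i [[li [li' [-> ->]]]|[j [li [lj [-> ->]]]]]]] := main p q pq qN epq.
      by exists l, i; left.
    by exists l, i; right; exists j.
move=> l i j li lj; have [pN yp] := pos _ _ li; have [qN yq] := pos _ _ lj.
rewrite /v; set p := st l + i.-1 in pN yp *; set q := st l.+1 + j.-1 in qN yq *.
rewrite eh //; have pq : p < q.
  by rewrite ltnNge; apply/negP => /(fold_row_mono d); rewrite -/y; lia.
move=> /(fold_rel_lt pq)[b [Ep Eq _]].
have [db bN nc] : [/\ d b <= b, b.+1 + d b < N & _] := dN b ltac:(lia).
(* With offset 0 the edge would be {b, b + 1} with both ends in one row. *)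
have d0 : 0 < d b.
  rewrite lt0n; apply/eqP => d0; move: yq; rewrite Eq (_ : b = p); last lia.
  rewrite (_ : p = b) ?d0; last lia.
  by rewrite addn0 /y /= d0 addn0 -/y (_ : b = p); lia.
have yb : y b = y p by apply: fold_row_const => [|c cb]; [|apply: nc]; lia.
have stb : st l.+1 = b.+1.
  have := stP l.+1 b.+1 ltac:(lia); have := stP l.+1 b ltac:(lia).
  by rewrite {2}/y /= -/y yb; lia.
have edge c : c.+1 < N -> d c = 0 -> e (h c) (h c.+1).
  by move=> cN dc; rewrite eh ?(@fold_rel_center _ c) ?dc //; lia.
split; last lia.
rewrite (_ : st l + (k l).-1 = p + d b); last by rewrite /k; lia.
rewrite (_ : st l.+1 + _ = b.+1) ?addn0 // Eq.
rewrite !(tree_gdist_run tree (w := h)) //.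
- by move=> c cb; apply: edge; [lia|apply: nc; lia].
- by move=> c c' cb cb' /hinj; apply; lia.
- by move=> c cb; apply: edge; [lia|apply: nc; lia].
- by move=> c c' cb cb' /hinj; apply; lia.
Qed.

(** * Walks in the grid *)

(** The embedding is studied with natural numbers as coordinates and indices, which opens it to
    linear arithmetic. *)
Definition adjacent (a b : nat * nat) : bool :=
  (a.1 == b.1) && ((a.2.+1 == b.2) || (b.2.+1 == a.2)) ||
  ((a.1.+1 == b.1) || (b.1.+1 == a.1)) && (a.2 == b.2).

Lemma adjacentC a b : adjacent a b = adjacent b a.
Proof. rewrite /adjacent; lia. Qed.

Definition grid_walk (N : nat) (P : nat -> nat * nat) : Prop :=
  (forall i, i.+1 < N -> adjacent (P i) (P i.+1)) /\
  (forall i j, i < N -> j < N -> P i = P j -> i = j).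

Definition straight_run (P : nat -> nat * nat) (s t : nat) : Prop :=
  s <= t /\ ((forall i, s <= i <= t -> (P i).1 = (P s).1) \/
             (forall i, s <= i <= t -> (P i).2 = (P s).2)).

Definition maximal_run (N : nat) (P : nat -> nat * nat) (s t : nat) : Prop :=
  [/\ t < N, straight_run P s t
    & forall s' t', s' <= s -> t <= t' -> t' < N -> straight_run P s' t' ->
        s' = s /\ t' = t].

Definition coords_of (n k l : nat) (f : 'I_n -> 'I_k * 'I_l)
    (P : nat -> nat * nat) : Prop :=
  forall i : 'I_n, P i = ((f i).1 : nat, (f i).2 : nat).

Lemma grid_irr k l : irreflexive (@grid k l).
Proof.
move=> [x y]; rewrite /grid /cartesian_product /path_graph /= !eqxx; lia.
Qed.

Section Coordinates.
Variables (n k l : nat) (f : 'I_n -> 'I_k * 'I_l) (P : nat -> nat * nat).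
Hypothesis fP : coords_of f P.

Lemma grid_adjacent i j : grid (f i) (f j) = adjacent (P i) (P j).
Proof. by rewrite !fP. Qed.

Lemma path_embeddingE : path_embedding f <-> grid_walk n P.
Proof.
split=> [[finj fadj]|[Padj Pinj]]; split.
- move=> i iN; have := fadj (Ordinal (ltnW iN)) (Ordinal iN).
  by rewrite grid_adjacent /path_graph /= eqxx; apply.
- move=> i j iN jN; rewrite (fP (Ordinal iN)) (fP (Ordinal jN)) => -[E1 E2].
  have : f (Ordinal iN) = f (Ordinal jN).
    by apply/eqP; rewrite -pair_eqE; apply/andP; split; apply/eqP/val_inj.
  by move/finj => [].
- by move=> i j E; apply/ord_inj/Pinj => //; rewrite !fP E.
- move=> i j /orP[]/eqP E; rewrite grid_adjacent; last rewrite adjacentC.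
    by rewrite -E; apply: Padj; rewrite E.
  by rewrite -E; apply: Padj; rewrite E.
Qed.

Lemma straightE s : straight f s <-> straight_run P s.1 s.2.
Proof.
split=> -[s12 [] H]; split=> //; [left|right|left|right] => i i_s.
- have iN : i < n by case/andP: i_s => _ /leq_ltn_trans; apply.
  by rewrite (fP (Ordinal iN)) fP /= H.
- have iN : i < n by case/andP: i_s => _ /leq_ltn_trans; apply.
  by rewrite (fP (Ordinal iN)) fP /= H.
- by apply: val_inj; have := H i i_s; rewrite !fP.
- by apply: val_inj; have := H i i_s; rewrite !fP.
Qed.

Lemma maximal_straightE s : maximal_straight f s <-> maximal_run n P s.1 s.2.
Proof.
split=> [[/straightE st max]|[_ st max]]; split=> //; try exact/straightE.
  move=> s' t' ss tt tN st'.
  have sN : s' < n by case: st' => /leq_ltn_trans + _; apply.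
  by have /= <- := max (Ordinal sN, Ordinal tN) 
    (proj2 (straightE (Ordinal sN, Ordinal tN)) st') ss tt.
move=> [t1 t2] /straightE st' /= le1 le2.
have [E1 E2] := max _ _ le1 le2 (ltn_ord _) st'.
by case: s E1 E2 {st max le1 le2} => s1 s2 /= /val_inj -> /val_inj ->.
Qed.

End Coordinates.

(** Reflection in the diagonal; it lets [fold_center] assume that the middle edge is vertical. *)
Definition flip (P : nat -> nat * nat) (i : nat) : nat * nat := ((P i).2, (P i).1).

Lemma adjacent_flip P i j : adjacent (flip P i) (flip P j) = adjacent (P i) (P j).
Proof. rewrite /adjacent /=; lia. Qed.

Lemma grid_walk_flip N P : grid_walk N P -> grid_walk N (flip P).
Proof.
case=> Padj Pinj; split=> [i /Padj|i j iN jN]; first by rewrite adjacent_flip.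
by rewrite /flip => -[E2 E1]; apply: Pinj => //;
  case: (P i) (P j) E1 E2 => ? ? [? ?] /= -> ->.
Qed.

Lemma straight_run_flip P s t : straight_run (flip P) s t <-> straight_run P s t.
Proof. by split=> -[st [] H]; split=> //; [right|left|right|left]. Qed.

Lemma maximal_run_flip N P s t : maximal_run N P s t -> maximal_run N (flip P) s t.
Proof.
case=> tN st max; split=> //; first exact/straight_run_flip.
by move=> s' t' ss tt tN' /straight_run_flip; apply: max.
Qed.

(** Each step changes the column by one, and a reversal of direction would revisit a point. *)
Lemma horizontal_run N P s m : grid_walk N P -> s + m < N ->
  (forall i, s <= i <= s + m -> (P i).2 = (P s).2) ->
  (P (s + m)).1 = (P s).1 + m \/ (P (s + m)).1 + m = (P s).1.
Proof.
case=> Padj Pinj sN Y; case: m sN Y => [|m] sN Y; first by rewrite !addn0; left.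
have step i : s <= i <= s + m ->
    (P i.+1).1 = (P i).1.+1 \/ (P i).1 = (P i.+1).1.+1.
  move=> im; have := Padj i ltac:(lia).
  by rewrite /adjacent (Y i) ?(Y i.+1); lia.
(* The induction carries the last two positions, since it needs the direction of the last step. *)
have : ((P (s + m)).1 = (P s).1 + m /\ (P (s + m.+1)).1 = (P s).1 + m.+1) \/
    ((P (s + m)).1 + m = (P s).1 /\ (P (s + m.+1)).1 + m.+1 = (P s).1).
  elim: m sN Y step => [|m IH] sN Y step.
    by have := step s; rewrite addn1 addn0; lia.
  have {}IH := IH ltac:(lia) (fun i im => Y i ltac:(lia)) (fun i im => step i ltac:(lia)).
  have := step (s + m.+1) ltac:(lia); rewrite -addnS.
  have : (P (s + m.+2)).1 <> (P (s + m)).1.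
    move=> E; have := Pinj (s + m.+2) (s + m) sN ltac:(lia).
    rewrite [P (s + m.+2)]surjective_pairing [P (s + m)]surjective_pairing E.
    by rewrite !Y; [move/(_ erefl)|..]; lia.
  by lia.
by case=> -[_ H]; [left|right].
Qed.

Lemma run_next N P b : grid_walk N P -> b.+1 < N ->
  (P b).1 = (P b.+1).1 /\ (P b).2 <> (P b.+1).2 \/
  (P b).2 = (P b.+1).2 /\ (P b).1 <> (P b.+1).1.
Proof. case=> Padj _ /Padj; rewrite /adjacent; lia. Qed.

(* If the walk turns the same way at both ends of {b, b + 1}, the outer segments
   run in opposite directions and mirror each other; otherwise only the ends
   of the middle edge itself are adjacent. *)
Lemma fold_center N P a b c u v : grid_walk N P ->
  maximal_run N P a b -> maximal_run N P b b.+1 -> maximal_run N P b.+1 c ->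
  a <= u <= b -> b < v <= c -> adjacent (P u) (P v) -> u + v = b.*2.+1.
Proof.
wlog E : P / (P b).1 = (P b.+1).1 /\ (P b).2 <> (P b.+1).2.
  move=> W walk La Lb Lc ua vc; have [bN _ _] := Lb.
  have [E|E] := run_next walk bN; first exact: (W P E).
  rewrite -adjacent_flip.
  by apply: W => //; try exact: maximal_run_flip; apply: grid_walk_flip.
move=> walk [bN [ab Sa] maxa] [bN' _ _] [cN [bc Sc] maxc] ua vc.
(* If this segment were vertical too, the middle edge would prolong it, against maximality. *)
have {}Sa : forall i, a <= i <= b -> (P i).2 = (P a).2.
  case: Sa => // Sa; suff: straight_run P a b.+1.
    by move/(maxa _ _ (leqnn a) (leqnSn b) bN') => []; lia.
  split; first lia; left=> i ai; case: (ltngtP i b.+1) => ib; [apply: Sa|..]; try lia.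
  by rewrite ib -(proj1 E) Sa //; lia.
have {}Sc : forall i, b < i <= c -> (P i).2 = (P b.+1).2.
  case: Sc => // Sc; suff: straight_run P b c.
    by move/(maxc _ _ (leqnSn b) (leqnn c) cN) => []; lia.
  split; first lia; left=> i bi; case: (ltngtP i b) => ib; try lia.
    by rewrite Sc ?(proj1 E) //; lia.
  by rewrite ib.
have Xu := @horizontal_run N P u (b - u) walk.
have Xv := @horizontal_run N P b.+1 (v - b.+1) walk.
rewrite subnKC in Xu; last lia; rewrite subnKC in Xv; last lia.
have {}Xu : (P b).1 = (P u).1 + (b - u) \/ (P b).1 + (b - u) = (P u).1.
  by apply: Xu => // i iu; rewrite !Sa //; lia.
have {}Xv : (P v).1 = (P b.+1).1 + (v - b.+1) \/ (P v).1 + (v - b.+1) = (P b.+1).1.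
  by apply: Xv => [|i iv]; [lia|rewrite !Sc //; lia].
rewrite /adjacent (Sc v) // (Sa u) // -(Sa b); last lia.
by lia.
Qed.

(** What a transformation amounts to once its new edge is known to be centred at [b]. It depends on
    the embedding only, not on the current graph. *)
Definition foldable (N : nat) (P : nat -> nat * nat) (b δ : nat) : Prop :=
  exists a c, [/\ maximal_run N P a b, maximal_run N P b b.+1,
    maximal_run N P b.+1 c, [/\ 0 < δ, a + δ <= b & b.+1 + δ <= c]
    & adjacent (P (b - δ)) (P (b.+1 + δ))].

Lemma maximal_run_eq N P s t s' t' :
  maximal_run N P s t -> maximal_run N P s' t' -> s' <= s -> t <= t' ->
  s' = s /\ t' = t.
Proof. by move=> [_ _ max] [tN st _] ss tt; apply: max. Qed.

Lemma adjacentP a b c d : adjacent (a, b) (c, d) ->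
  [\/ a = c /\ d = b.+1, a = c /\ b = d.+1, c = a.+1 /\ b = d
    | a = c.+1 /\ b = d].
Proof.
rewrite /adjacent /= => H; case: (eqVneq a c) H => [->|_] H.
  by case: (eqVneq b d.+1) H => ? H; [constructor 2|constructor 1]; lia.
by case: (eqVneq a c.+1) H => ? H; [constructor 4|constructor 3]; lia.
Qed.

(** Two distinct common neighbours of [p] and [q] form the other diagonal of a unit square, so
    either one determines the other. *)
Lemma unit_square (p q x y : nat * nat) : p <> q -> x <> y ->
  adjacent p x -> adjacent x q -> adjacent p y -> adjacent y q ->
  x.1 + y.1 = p.1 + q.1 /\ x.2 + y.2 = p.2 + q.2.
Proof.
move: p q x y => [p1 p2] [q1 q2] [x1 x2] [y1 y2] pq xy.
have {}pq : p1 <> q1 \/ p2 <> q2.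
  case: (eqVneq p1 q1) pq => [->|/eqP]; last by left.
  by case: (eqVneq p2 q2) => [->|/eqP]; [|right].
have {}xy : x1 <> y1 \/ x2 <> y2.
  case: (eqVneq x1 y1) xy => [->|/eqP]; last by left.
  by case: (eqVneq x2 y2) => [->|/eqP]; [|right].
move=> /adjacentP A1 /adjacentP A2 /adjacentP A3 /adjacentP A4 /=.
by case: A1 => -[? ?]; case: A2 => -[? ?]; case: A3 => -[? ?];
  case: A4 => -[? ?]; subst; lia.
Qed.

(* Overlapping replacements would have consecutive centres b and b + 1, and then
   the points b - 1 and b + 3 would both close the unit square at b, b + 1, b + 2. *)
Lemma foldable_apart N P b δ b' δ' : grid_walk N P ->
  foldable N P b δ -> foldable N P b' δ' -> b < b' ->
  b + δ < b' /\ b < b' - δ'.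
Proof.
move=> [Padj Pinj] [a [c [La Lb Lc [d0 ad dc] A]]].
move=> [a' [c' [La' Lb' Lc' [d0' ad' dc'] A']]] bb'.
suff : ~ (b' <= b + δ \/ b' - δ' <= b) by lia.
(* In an overlap, one middle edge lies inside an outer segment of the other transformation; both
   being maximal, they coincide. *)
move=> H; have Eb : b' = b.+1.
  case: H => H.
    by have [] := maximal_run_eq Lb' Lc; lia.
  by have [] := maximal_run_eq Lb La'; lia.
subst b'.
have [Ea' _] : a' = b /\ b.+1 = b.+1 by apply: (maximal_run_eq Lb La'); lia.
have [_ Ec] : b.+1 = b.+1 /\ c = b.+2 by apply: (maximal_run_eq Lb' Lc); lia.
have [? ?] : δ = 1 /\ δ' = 1 by lia.
subst δ δ'; have [cN _ _] := Lc'.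
move: A A'; rewrite !addn1 !subn1 /= => A A'.
have neq i j : i < N -> j < N -> i <> j -> P i <> P j.
  by move=> iN jN ij /(Pinj _ _ iN jN).
have n1 : P b <> P b.+2 by apply: neq; lia.
have n2 : P b.-1 <> P b.+1 by apply: neq; lia.
have n3 : P b.+3 <> P b.+1 by apply: neq; lia.
have n4 : P b.-1 <> P b.+3 by apply: neq; lia.
have A0 : adjacent (P b.-1) (P b) by rewrite -{2}(prednK (n := b)); [apply: Padj|]; lia.
have A1 : adjacent (P b) (P b.+1) by apply: Padj; lia.
have A2 : adjacent (P b.+1) (P b.+2) by apply: Padj; lia.
have A3 : adjacent (P b.+2) (P b.+3) by apply: Padj; lia.
have A4 : adjacent (P b.+3) (P b.+2) by rewrite adjacentC.
have A5 : adjacent (P b) (P b.-1) by rewrite adjacentC.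
have [E1 E2] := unit_square n1 n2 A5 A A1 A2.
have [E3 E4] := unit_square n1 n3 A' A4 A1 A2.
apply: n4; rewrite [LHS]surjective_pairing [RHS]surjective_pairing; congr pair.
  by move: E1 E3; clear; lia.
by move: E2 E4; clear; lia.
Qed.

(** The invariant says that the current graph is a [fold_rel] whose positive offsets are all
    [foldable]. Disjointness of the replacements is read off at the end from [foldable_apart],
    because the embedding never changes. *)
Lemma path_like_folded (T : finType) (e : rel T) :
  is_tree e -> path_like e -> folded e.
Proof.
move=> [_ T0 _ _] [n [k [l [f [L [g [emb segs trans [h0 hbij hiso]]]]]]]].
case: n f L g emb segs trans h0 hbij hiso => [|n] f L g emb segs trans h0 hbij hiso.
  have /card_gt0P[x _] := T0; case: hbij => h1 _ _.
  by case: (h1 x).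
pose P i := ((f (inord i)).1 : nat, (f (inord i)).2 : nat).
have fP : coords_of f P by move=> i; rewrite /P inord_val.
have walk : grid_walk n.+1 P by apply/(path_embeddingE fP).
pose Inv (g : rel 'I_n.+1) := exists d : nat -> nat,
  (forall b, 0 < d b -> foldable n.+1 P b (d b)) /\
  forall i j, g i j = fold_rel d i j.
have Inv0 : Inv (@path_graph n.+1).
  exists (fun=> 0); split=> // i j; rewrite /path_graph /fold_rel; lia.
have Inv_step g1 g2 : elementary_transformation f L g1 g2 -> Inv g1 -> Inv g2.
  case=> [[a b] [[b0 b1] [[b1' c] [u [v [inL Lb2 [uin vin uv] [gb gu] g2E]]]]]].
  move=> [d [dfold g1E]]; rewrite /= in Lb2 gb g2E uin vin.
  have [uL memL sortL] := segs.
  have /infixP[s1 [s2 EL]] := inL.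
  have [/= /eqP ? /eqP ?] : b == b0 /\ b1 == b1'.
    move: sortL; rewrite EL; case: s1 {EL} => [|? ?] /=; rewrite ?cat_path /=.
      by case/and3P=> -> ->.
    by case/and5P=> _ _ -> ->.
  subst b0 b1'.
  have mx s : s \in [:: (a, b); (b, b1); (b1, c)] -> maximal_run n.+1 P s.1 s.2.
    move=> sin; apply/(maximal_straightE fP)/memL.
    by rewrite EL !mem_cat sin orbT.
  have /= La : maximal_run n.+1 P (a, b).1 (a, b).2.
    by apply: mx; rewrite !inE eqxx.
  have /= Lb : maximal_run n.+1 P (b, b1).1 (b, b1).2.
    by apply: mx; rewrite !inE eqxx orbT.
  have /= Lc : maximal_run n.+1 P (b1, c).1 (b1, c).2.
    by apply: mx; rewrite !inE eqxx !orbT.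
  rewrite Lb2 in Lb Lc; rewrite /in_segment /= ?Lb2 in uin vin.
  have A : adjacent (P u) (P v).
    by rewrite -(grid_adjacent fP) -gdist_eq1 ?uv //; apply: grid_irr.
  have E := fold_center walk La Lb Lc uin vin A.
  have db : d b = 0.
    by move: gb; rewrite g1E (@fold_rel_center _ b) ?Lb2; lia.
  (* For [u = b] the new edge would be {b, b + 1} itself, which is present in [g1]. *)
  have ub : u < b.
    by move: gu; rewrite g1E (@fold_rel_center _ b) // ?db; lia.
  exists (fun c => if c == b :> nat then b - u else d c); split.
    move=> b' /=; case: eqP => [->|_]; last exact: dfold.
    move=> _; exists a, c; split=> //; first by split; lia.
    rewrite (_ : b - (b - u) = u); last lia.
    by rewrite (_ : b.+1 + (b - u) = v) //; lia.
  move=> i j; rewrite g2E /replace_edge g1E !eq_set2 -!(inj_eq val_inj) /= Lb2.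
  rewrite [RHS](fold_rel_replace i j (b := b) db) /= ?eqxx; last first.
  - by move=> c' /negbTE ->.
  - by lia.
  rewrite (_ : b - (b - u) = u); last lia.
  by rewrite (_ : b.+1 + (b - u) = v) //; lia.
have {trans} [d [dfold gE]] : Inv g.
  by elim: trans Inv0 => [x y /Inv_step//|//|x y z _ IH1 _ IH2 /IH1/IH2].
exists n.+1, d, (h0 \o inord); split.
- split=> // b bN; case: (posnP (d b)) => d0; first by rewrite d0; split=> //; lia.
  have [a [c [_ _ [cN _ _] [_ ad dc] _]]] := dfold b d0.
  split; [lia|lia|] => _ c' cb ncb.
  apply/eqP; rewrite -leqn0 leqNgt; apply/negP => dc0.
  case: (ltngtP b c') ncb => // bc _.
    by have := foldable_apart walk (dfold b d0) (dfold c' dc0) bc; lia.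
  by have := foldable_apart walk (dfold c' dc0) (dfold b d0) bc; lia.
- move=> p q pN qN /(bij_inj hbij) /(congr1 val) /=; rewrite !inordK //.
- move=> x; have [h1 _ hK] := hbij; exists (h1 x) => //=.
  by rewrite inord_val hK.
- by move=> p q pN qN /=; rewrite hiso gE !inordK.
Qed.

(** * The zigzag embedding *)

(** Links the list of consecutive cuts to the description of segments in [zigzag_maximal]. *)
Lemma mem_pairmap_pair (x : nat) (C : seq nat) (s t : nat) : path ltn x C ->
  (s, t) \in pairmap pair x C <->
  [/\ s \in x :: C, t \in x :: C, s < t & forall c, c \in C -> ~~ (s < c < t)].
Proof.
elim: C x => [|y C IH] x /=.
  by rewrite in_nil => _; split=> // -[]; rewrite !inE => /eqP-> /eqP->; rewrite ltnn.
case/andP=> xy yC; have y_min c : c \in C -> y < c.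
  by apply/allP; apply: (order_path_min ltn_trans).
rewrite inE; split.
  case/predU1P=> [[-> ->]|/(IH y yC)[sC tC st nC]].
    split; rewrite ?inE ?eqxx ?orbT // => c; rewrite inE => /predU1P[->|/y_min]; lia.
  split=> //; rewrite 1?inE ?sC ?tC ?orbT // => c; rewrite inE => /predU1P[->|/nC//].
  by move: sC; rewrite inE => /predU1P[->|/y_min]; lia.
case=> sC tC st nC; have := nC y (mem_head _ _).
move: sC; rewrite inE => /predU1P[Es|sC] nxt.
  subst s; move: tC; rewrite inE => /predU1P[?|]; first lia.
  rewrite inE => /predU1P[->|/y_min]; first by rewrite eqxx.
  lia.
have ys : y <= s by move: sC; rewrite inE => /predU1P[->//|/y_min]; lia.
apply/orP; right; apply/(IH y yC); split=> //.
  by move: tC; rewrite inE => /predU1P[?|//]; lia.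
by move=> c cC; apply: nC; rewrite inE cC orbT.
Qed.

Lemma path_pairmap_pair (T : eqType) (x y : T) (C : seq T) :
  path (fun s t : T * T => s.2 == t.1) (y, x) (pairmap pair x C).
Proof. by elim: C x y => //= z C IH x y; rewrite eqxx IH. Qed.

(* The walk turns back after each vertical step. Starting at column N keeps the
   predecessor from truncating. *)
Fixpoint fold_col (N : nat) (d : nat -> nat) (p : nat) : nat :=
  if p is q.+1 then
    if 0 < d q then fold_col N d q
    else if odd (fold_row d q) then (fold_col N d q).-1 else (fold_col N d q).+1
  else N.

Definition zigzag N d p := (fold_col N d p, fold_row d p).

Lemma fold_col_bounds N d p : N - p <= fold_col N d p <= N + p.
Proof. elim: p => [|p IH] /=; [lia|case: ifP => _; [|case: ifP => _]; lia]. Qed.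

Lemma fold_row_bound d p : fold_row d p <= p.
Proof. elim: p => [|p IH] //=; lia. Qed.

Lemma fold_col_run N d p m : p + m <= N ->
  (forall c, p <= c < p + m -> d c = 0) ->
  if odd (fold_row d p) then fold_col N d (p + m) + m = fold_col N d p
  else fold_col N d (p + m) = fold_col N d p + m.
Proof.
elim: m => [|m IH] pN d0; first by rewrite !addn0; case: ifP.
have {}IH := IH ltac:(lia) (fun c cm => d0 c ltac:(lia)).
have yc : fold_row d (p + m) = fold_row d p.
  by apply: fold_row_const => [|c cm]; [|apply: d0]; lia.
rewrite [p + m.+1]addnS /= d0 /= ?yc; last lia.
have := fold_col_bounds N d (p + m).
by case: (odd _) IH => /=; lia.
Qed.

Section Zigzag.
Variables (N : nat) (d : nat -> nat).
Hypothesis dN : fold_data N d.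
Local Notation P := (zigzag N d).

Lemma zigzag_step i : i.+1 < N ->
  if 0 < d i then (P i.+1).1 = (P i).1 /\ (P i.+1).2 = (P i).2.+1
  else ((P i.+1).1 = (P i).1.+1 \/ (P i).1 = (P i.+1).1.+1) /\
       (P i.+1).2 = (P i).2.
Proof.
move=> iN; have := fold_col_bounds N d i; rewrite /zigzag /=.
case: (0 < d i) => /=; first by lia.
by case: ifP => _; lia.
Qed.

Lemma zigzag_walk : grid_walk N P.
Proof.
split=> [i iN|].
  by have := zigzag_step iN; rewrite /adjacent; case: ifP => _; lia.
(* Equal heights exclude a vertical step in between, and along one row the column is strictly
   monotone. *)
have lt i j : i < j -> j < N -> P i <> P j.
  move=> ij jN [Ex Ey].
  have d0 c : i <= c < j -> d c = 0.
    move=> cij; have := fold_row_mono d (p := i) (q := c).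
    have := fold_row_mono d (p := c.+1) (q := j); rewrite /=; lia.
  have := @fold_col_run N d i (j - i).
  by rewrite subnKC; [case: ifP => _ H; have := H ltac:(lia) d0|]; lia.
by move=> i j iN jN E; case: (ltngtP i j) => // /lt; [move/(_ jN)|move/(_ iN)]; rewrite E.
Qed.

(** The rows below and above the vertical step run in opposite directions, so going [d b] back from
    [b] and [d b] on from [b.+1] leads to the same column. *)
Lemma zigzag_fold b : b.+1 < N -> adjacent (P (b - d b)) (P (b.+1 + d b)).
Proof.
move=> bN; have [db dbN nc] := dN bN.
case: (posnP (d b)) => d0.
  by rewrite d0 subn0 addn0; apply: (proj1 zigzag_walk).
have yb : fold_row d b = fold_row d (b - d b).
  by apply: fold_row_const => [|c cb]; [|apply: nc]; lia.
have yv : fold_row d (b.+1 + d b) = fold_row d b.+1.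
  by apply: fold_row_const => [|c cb]; [|apply: nc]; lia.
have := @fold_col_run N d (b - d b) (d b); rewrite subnK //.
move/(_ ltac:(lia) (fun c cm => nc d0 c ltac:(lia) ltac:(lia))).
have := @fold_col_run N d b.+1 (d b).
move/(_ ltac:(lia) (fun c cm => nc d0 c ltac:(lia) ltac:(lia))).
rewrite /= d0 -yb addn1 /= /adjacent /zigzag -yb yv /= d0 addn1 eqxx.
by case: (odd _) => /=; lia.
Qed.

(** The ends of the walk and of its vertical steps. At [i = 0] the truncated [i.-1] is harmless, as
    0 is a cut anyway. *)
Definition cut i := [|| i == 0, i == N.-1, 0 < d i.-1 | 0 < d i].

(** Two vertical steps are never consecutive by [fold_data], so at an inner cut one step is vertical
    and the other horizontal. *)
Lemma cut_turn i s t : 0 < i -> i.+1 < N -> cut i -> s < i -> i < t -> t < N ->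
  ~ straight_run P s t.
Proof.
move=> i0 iN ci si it tN [_ S].
have {}S : ((P i.-1).1 = (P i).1 /\ (P i.+1).1 = (P i).1) \/
           ((P i.-1).2 = (P i).2 /\ (P i.+1).2 = (P i).2).
  by case: S => S; [left|right]; rewrite (S i.-1) ?(S i) ?(S i.+1) //; lia.
have := @zigzag_step i.-1; rewrite prednK // => /(_ ltac:(lia)).
have := zigzag_step iN.
have [_ _ nc] := dN iN.
have [_ _ nc'] := @dN i.-1 ltac:(lia).
move: ci; rewrite /cut; case: (posnP (d i)) => di; case: (posnP (d i.-1)) => di'.
- by lia.
- by lia.
- by lia.
- by have := nc di i.-1; lia.
Qed.

Lemma zigzag_maximal s t : 1 < N -> t < N ->
  maximal_run N P s t <->
  [/\ cut s, cut t, s < t & forall c, c < N -> cut c -> ~~ (s < c < t)].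
Proof.
move=> N1 tN; have pair_straight i : i.+1 < N -> straight_run P i i.+1.
  move=> iN; split=> //; have := zigzag_step iN; case: ifP => _ [H1 H2].
    by left=> j ij; have [->|->] : j = i \/ j = i.+1 by lia.
  by right=> j ij; have [->|->] : j = i \/ j = i.+1 by lia.
split.
  case=> _ [st S] max.
  have lt_st : s < t.
    rewrite ltn_neqAle st andbT; apply/eqP => E; subst t.
    case: (ltnP s.+1 N) => sN.
      by have := max s s.+1 (leqnn s) (leqnSn s) sN (pair_straight s sN); lia.
    have := max s.-1 s ltac:(lia) (leqnn s) tN.
    have := pair_straight s.-1; rewrite prednK; last lia.
    by move=> /(_ tN) S' /(_ S'); lia.
  split=> //.
  (* At an inner position that is not a cut both steps are horizontal, so the run could be prolonged
     backwards. *)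
  - apply/negPn/negP; rewrite /cut !negb_or -!leqNgt !leqn0.
    case/and4P=> s0 sN /eqP d1 /eqP d2.
    have H := @zigzag_step s ltac:(lia).
    have H' := @zigzag_step s.-1; rewrite prednK in H'; last lia.
    have {H'} := H' ltac:(lia); move: H; rewrite d1 d2 ltnn => H H'.
    case: S => S; first by have := S s.+1 ltac:(lia); lia.
    have : straight_run P s.-1 t.
      split; first lia; right=> i i_st; case: (ltnP i s) => is_.
        by have -> : i = s.-1 by lia.
      by rewrite S; lia.
    by move/(max s.-1 t ltac:(lia) (leqnn t) tN); lia.
  - apply/negPn/negP; rewrite /cut !negb_or -!leqNgt !leqn0.
    case/and4P=> t0 tN' /eqP d1 /eqP d2.
    have H := @zigzag_step t ltac:(lia).
    have H' := @zigzag_step t.-1; rewrite prednK in H'; last lia.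
    have {H'} := H' ltac:(lia); move: H; rewrite d1 d2 ltnn => H H'.
    case: S => S.
      by have := S t.-1 ltac:(lia); have := S t ltac:(lia); lia.
    have : straight_run P s t.+1.
      split; first lia; right=> i i_st; case: (ltnP t i) => it.
        have -> : i = t.+1 by lia.
        by rewrite (proj2 H) S; lia.
      by rewrite S; lia.
    by move/(max s t.+1 (leqnn s) (leqnSn t) ltac:(lia)); lia.
  - move=> c cN cc; apply/negP => /andP[sc ct].
    by apply: (cut_turn (i := c) (s := s) (t := t)) => //; lia.
case=> cs ct st nc.
have S : straight_run P s t.
  have [ds|ds] := posnP (d s).
    split; first lia; right=> i i_st; apply: fold_row_const => [|c cs']; first lia.
    have [->//|cs''] := eqVneq c s.
    by have := nc c ltac:(lia); rewrite /cut; lia.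
  have -> : t = s.+1 by have := nc s.+1; rewrite /cut /=; lia.
  by apply: pair_straight; lia.
split=> // s' t' ss tt tN' S'; split; apply/eqP.
  rewrite eqn_leq ss leqNgt; apply/negP => lt.
  by apply: (cut_turn (i := s) _ _ _ _ _ _ S') => //; lia.
rewrite eqn_leq tt andbT leqNgt; apply/negP => lt.
by apply: (cut_turn (i := t) _ _ _ _ _ _ S') => //; lia.
Qed.

End Zigzag.

(** * Maximal segments of the zigzag *)

Section ZigzagSegments.
Variables (n k l : nat) (d : nat -> nat) (f : 'I_n.+1 -> 'I_k * 'I_l).
Hypotheses (dN : fold_data n.+1 d) (fP : coords_of f (zigzag n.+1 d)).

Definition cuts := [seq i <- iota 1 n | cut n.+1 d i].
Definition to_ord (s : nat * nat) : 'I_n.+1 * 'I_n.+1 := (inord s.1, inord s.2).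

(* For n = 0 the walk is one point, which is a maximal segment by itself
   although it is not delimited by two distinct cuts. *)
Definition zigzag_segments :=
  if n == 0 then [:: (ord0, ord0)] else map to_ord (pairmap pair 0 cuts).

Lemma zigzag_segmentsE : 0 < n ->
  zigzag_segments = map to_ord (pairmap pair 0 cuts).
Proof. by rewrite /zigzag_segments eqn0Ngt => ->. Qed.

Lemma cuts_path : path ltn 0 cuts.
Proof.
have : sorted ltn (iota 0 n.+1) by apply: iota_ltn_sorted.
move=> /(sorted_filter ltn_trans (cut n.+1 d)).
by rewrite /= /cut.
Qed.

Lemma mem_cuts i : (i \in 0 :: cuts) = (i <= n) && cut n.+1 d i.
Proof.
rewrite inE mem_filter mem_iota /cut; case: i => [|i] //=.
by rewrite andbC ltnS.
Qed.

Lemma pairmap_cuts_bound s : s \in pairmap pair 0 cuts -> s.1 <= n /\ s.2 <= n.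
Proof.
case: s => s t /(mem_pairmap_pair _ _ cuts_path)[].
by rewrite !mem_cuts => /andP[? _] /andP[? _].
Qed.

Lemma to_ordK s : s \in pairmap pair 0 cuts ->
  ((to_ord s).1 : nat, (to_ord s).2 : nat) = s.
Proof.
by case: s => s t /pairmap_cuts_bound[/= s_n t_n]; rewrite !inordK.
Qed.

Lemma zigzag_segmentsP : straight_segments f zigzag_segments.
Proof.
have [n0|n0] := posnP n.
  have ord10 (i : 'I_n.+1) : i = ord0.
    by apply: val_inj; case: i => i iN /=; lia.
  have all0 (s : 'I_n.+1 * 'I_n.+1) : s = (ord0, ord0).
    by case: s => s t; rewrite (ord10 s) (ord10 t).
  rewrite /zigzag_segments (introT eqP n0).
  split=> // s; split=> _; last by rewrite (all0 s) inE.
  split=> [|t _ _ _]; last by rewrite (all0 s) (all0 t).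
  by split; [rewrite (all0 s)|left=> i _; rewrite (ord10 i) (ord10 s.1)].
rewrite zigzag_segmentsE //; split.
- rewrite map_inj_in_uniq.
    (* The second ends of the segments are just the list [cuts], without repetition. *)
    apply: (@map_uniq _ _ snd).
    have -> : map snd (pairmap pair 0 cuts) = cuts.
      by elim: (cuts) 0 => //= x C IH y; rewrite IH.
    by rewrite filter_uniq ?iota_uniq.
  by move=> s t /to_ordK {2}<- /to_ordK {2}<- ->.
- case=> s t; rewrite (maximal_straightE fP) (zigzag_maximal dN) //=.
  have -> : ((s, t) \in map to_ord (pairmap pair 0 cuts)) =
      ((s : nat, t : nat) \in pairmap pair 0 cuts).
    apply/mapP/idP => [[p pin E']|pin].
      by have := to_ordK pin; rewrite -E' /= => ->.
    by exists (s : nat, t : nat) => //; rewrite /to_ord /= !inord_val.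
  rewrite (mem_pairmap_pair _ _ cuts_path) !mem_cuts !leq_ord /=.
  split=> -[cs ct st nc]; split=> // c.
    move=> cN cc; have := nc c; have : c \in 0 :: cuts by rewrite mem_cuts -ltnS cN.
    by rewrite inE => /predU1P[->|cin /(_ cin)].
  move=> cin; have : c \in 0 :: cuts by rewrite inE cin orbT.
  by rewrite mem_cuts => /andP[? ?]; apply: nc.
- rewrite sorted_map; apply: sub_sorted (path_sorted (path_pairmap_pair 0 0 cuts)).
  by move=> p q /eqP E' /=; rewrite E'.
Qed.

(** By [fold_data] no cut lies strictly within distance [d b] of the vertical step, so both outer
    segments are long enough for the new edge. *)
Lemma zigzag_infix b : b < n -> 0 < d b ->
  exists a c, [/\ infix [:: to_ord (a, b); to_ord (b, b.+1); to_ord (b.+1, c)]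
                     zigzag_segments,
                  a + d b <= b & b.+1 + d b <= c <= n].
Proof.
move=> bn db; have [d_b dbn nc] := @dN b ltac:(lia).
pose A := [seq i <- iota 1 b.-1 | cut n.+1 d i].
pose C := [seq i <- iota b.+2 (n - b.+1) | cut n.+1 d i].
have cutsE : cuts = A ++ [:: b, b.+1 & C].
  rewrite /cuts (_ : n = b.-1 + (2 + (n - b.+1))); last lia.
  rewrite iotaD filter_cat iotaD filter_cat.
  rewrite (_ : b.-1 + (2 + (n - b.+1)) = n); last lia.
  rewrite (_ : 1 + b.-1 = b); last lia.
  rewrite addn2.
  by rewrite /= {2 3}/cut /= db !orbT.
have ain : last 0 A \in 0 :: A by apply: mem_last.
(* The end of the walk is a cut, which guarantees a segment after the vertical step. *)
have : n \in C by rewrite mem_filter mem_iota /cut /= eqxx orbT /=; lia.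
case EC : C => [|c C'] // _.
have : c \in C by rewrite EC mem_head.
rewrite mem_filter mem_iota => /andP[cc cn].
exists (last 0 A), c; split; last 1 first.
- rewrite leqNgt (_ : c <= n); last lia; rewrite andbT; apply/negP => lt.
  have := nc db c.-1 ltac:(lia) ltac:(lia); have := nc db c ltac:(lia) ltac:(lia).
  by move: cc; rewrite /cut /=; lia.
- apply/infixP; rewrite zigzag_segmentsE ?cutsE ?EC ?pairmap_cat ?map_cat; last lia.
  by exists (map to_ord (pairmap pair 0 A)), (map to_ord (pairmap pair c C')).
- move: ain; rewrite inE mem_filter mem_iota => /predU1P[->|/andP[ca an]]; first lia.
  rewrite leqNgt; apply/negP => lt; set a := last 0 A in ca an lt.
  have := nc db a.-1 ltac:(lia) ltac:(lia); have := nc db a ltac:(lia) ltac:(lia).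
  by move: ca; rewrite /cut /=; lia.
Qed.

End ZigzagSegments.

(** The edges are replaced from left to right in the zigzag drawing; [dm m] keeps only the
    replacements with centre below [m]. *)
Lemma folded_path_like (T : finType) (e : rel T) : folded e -> path_like e.
Proof.
move=> [[|n] [d [h [[// _ dN] hinj hsurj eh]]]].
pose P := zigzag n.+1 d.
pose k := n.+1 + n.+1; pose l := n.
pose f (i : 'I_n.+1) : 'I_k.+1 * 'I_l.+1 := (inord (P i).1, inord (P i).2).
have fP : coords_of f P.
  move=> i; rewrite /f !inordK; first exact: surjective_pairing.
    by rewrite ltnS; apply: leq_trans (fold_row_bound _ _) _; rewrite -ltnS.
  by have := fold_col_bounds n.+1 d i; have := ltn_ord i; rewrite /k /=; lia.
have emb : path_embedding f by apply/(path_embeddingE fP)/zigzag_walk.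
pose L := zigzag_segments n d.
have segs : straight_segments f L by apply: zigzag_segmentsP.
pose dm m b := if b < m then d b else 0.
have trans m : m <= n -> exists2 g : rel 'I_n.+1,
    clos_refl_trans _ (elementary_transformation f L) (@path_graph n.+1) g &
    forall i j, g i j = fold_rel (dm m) i j.
  elim: m => [|m IH] mn.
    exists (@path_graph n.+1); first exact: rt_refl.
    by move=> i j; rewrite /path_graph /fold_rel /dm ltn0; lia.
  have [g trg gE] := IH (ltnW mn).
  case: (posnP (d m)) => dm0.
    exists g => // i j; rewrite gE /fold_rel; congr (_ && (_ + _ == _)).
    rewrite /dm; case: (eqVneq (i + j)./2 m) => [->|neq].
      by rewrite ltnn ltnSn dm0.
    by rewrite ltnS [in RHS]leq_eqVlt (negbTE neq).
  have [a [c [inL am mc]]] := zigzag_infix dN mn dm0.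
  have [dmm dmn _] := @dN m ltac:(lia).
  pose g' : rel 'I_n.+1 := fun i j => fold_rel (dm m.+1) i j.
  exists g' => //; apply: rt_trans trg (rt_step _ _ _ _ _).
  exists (inord a, inord m), (inord m, inord m.+1), (inord m.+1, inord c).
  exists (inord (m - d m)), (inord (m.+1 + d m)).
  split=> //=; rewrite ?inordK //; try lia.
  - split; rewrite /in_segment /= ?inordK //; try lia.
    apply/eqP; rewrite gdist_eq1; last exact: grid_irr.
    by rewrite (grid_adjacent fP) !inordK; [apply: (zigzag_fold dN)|..]; lia.
  - rewrite !gE !inordK; try lia.
    by rewrite !(@fold_rel_center _ m) /dm ?ltnn; lia.
  - move=> i j; rewrite /g' /replace_edge !eq_set2 -!(inj_eq val_inj) /= gE.
    rewrite !inordK; try lia.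
    have E : dm m.+1 m = d m by rewrite /dm ltnSn.
    rewrite (@fold_rel_replace (dm m) (dm m.+1) m) ?E //; first by rewrite /dm ltnn.
    by move=> c' c'm; rewrite /dm ltnS leq_eqVlt (negbTE c'm).
have [g trg gE] := trans n (leqnn n).
exists n.+1, k.+1, l.+1, f, L, g; split=> //.
exists (fun i : 'I_n.+1 => h i) => [|i j].
  have inj : injective (fun i : 'I_n.+1 => h i).
    by move=> i j /hinj E; apply: ord_inj; apply: E.
  exists (fun x => odflt ord0 [pick i : 'I_n.+1 | h i == x]) => [i|x].
    case: pickP => [j /eqP/inj//|/(_ i)]; by rewrite eqxx.
  case: pickP => [j /eqP//|none]; have [p pN px] := hsurj x.
  by have := none (Ordinal pN); rewrite /= px eqxx.
rewrite eh // gE /fold_rel; case: (boolP (odd _)) => //= o.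
(* An odd sum of two indices up to [n] is at most 2n - 1, so the centre is below [n]. *)
congr (_ + _ == _); rewrite /dm ifT //.
by have := ltn_ord i; have := ltn_ord j; lia.
Qed.

Theorem theorem2 (T : finType) (e : rel T) (hT : is_tree e) :
  admits_linear_configuration e <-> path_like e.
Proof.
split=> [/(linear_folded hT)|/(path_like_folded hT)].
  exact: folded_path_like.
exact: folded_linear.
Qed.
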